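(* Consider the abstract budgeted query model described in the context, and let $\mathrm{query}$ be any one of $\mathrm{query}_{\mathrm{ext}}$, $\mathrm{query}_{\mathrm{int}}$, $\mathrm{query}_{\mathrm{lim}}$ (for $\mathrm{query}_{\mathrm{int}}$, all elements of $A$ are integers). Then the number of expansions made by DovIBEX (run until a terminating query is made) is at most $Z\lfloor \log_2 Z\rfloor$, where $Z = 2 n_*\, n_{\mathrm{exp}}(C_{\min}, C^*, \delta(C^* ))$, and is also at most $O(Z'\log Z')$ where $$Z' = \min_{b \ge n_*} b\, n_{\mathrm{exp}}(C_{\min}, C^*, C_{\mathrm{crit}}(b) - C^* ).$$
   Context: Abstract model. Let $A$ be a nondecreasing list of real numbers, each at least $1$, possibly with repetitions (counted separately). For $C\ge 1$ let $n(C) = |\{v \in A : v \le C\}|$. Fix $C^* \in A$, $n_* = n(C^* )$, $C_{\min} = \min A$. For a budget $b$ let $C_{\mathrm{crit}}(b) = \min\{v\in A : n(v) > b\}$. Let $A_{>}(C) = \min\{v\in A: v > C\}$, $A_{\le}(C) = \max\{v \in A : v\le C\}$, and for $C\in A$, $\delta(C) = A_{>}(C) - A_{\le}(C)$. Queries. A query with cost limit $C$ and budget $b$ performs at most $\min\{b,n(C)\}$ expansions; if $n_* \le n(C) \le b$ it is terminating (ends the whole interaction with an optimal solution); otherwise it returns an interval containing $C_{\mathrm{crit}}(b)$: - limited feedback: $\mathrm{query}_{\mathrm{lim}}(C,b) = [C,\infty]$ if $C < C_{\mathrm{crit}}(b)$, and $[1,C]$ otherwise; - integer feedback (used when $A$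 contains only integers): $\mathrm{query}_{\mathrm{int}}(C,b) = [\lfloor C\rfloor + 1, \infty]$ if $C < C_{\mathrm{crit}}(b)$, and $[1,C]$ otherwise; - extended feedback: $\mathrm{query}_{\mathrm{ext}}(C,b) = [A_{>}(C),\infty]$ if $C < C_{\mathrm{crit}}(b)$, and $[1,v]$ for some arbitrary $v \in [C_{\mathrm{crit}}(b), C]\cap A$ otherwise. The number of expansions of an algorithm is the sum of expansions over all its queries. Uniform Budgeted Scheduler (UBS) with a function $T:\{1,2,\ldots\}\times\{0,1,\ldots\}\to\{0,1,\ldots\}$ and a procedure run_prog: maintain a priority queue of pairs $(k,r)$ ordered by $T(k,r)$, initially containing $(1,1)$; while nonempty, extract a pair $(k,r)$ of minimal $T$-value, call run_prog$(k, T(k,r)-T(k,r-1))$; if it does not return ''halted'', insert $(k,r+1)$; if $r = 1$, insert $(k+1,1)$. DovIBEX: UBS with $T(k,r) = r2^k$ (so each call for program $k$ has budget $2^k$) and the following run_prog$(k,b)$: retrieve program $k$'s stored interval $[C_{\mathrm{low}}, C_{\mathrm{high}}]$ (initially $[C_{\min}, \infty]$); if $C_{\mathrm{high}} = \infty$ set $C = 2C_{\mathrm{low}}$, else $C = (C_{\mathrm{low}}+C_{\mathrm{high}})/2$; replace $[C_{\mathrm{low}}, C_{\mathrm{high}}]$ by $[C_{\mathrm{low}}, C_{\mathrm{high}}]\cap \mathrm{query}(C,b)$; if $C_{\mathrm{low}} \ge C_{\mathrm{high}}$ return ''halted''; otherwise store $[C_{\mathrm{low}}, C_{\mathrm{high}}]$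 as program $k$'s state. (Each call makes exactly one query; the expansions it makes are its steps.) Notation: $\lceil x\rceil_{\ge a} = \max\{a,\lceil x\rceil\}$, $\lfloor x\rfloor_{\ge a} = \max\{a, \lfloor x\rfloor\}$, $n_{\mathrm{exp}}(\varepsilon,x,\Delta) = 1 + \lceil\log_2(x/\varepsilon)\rceil_{\ge 1} + \lfloor \log_2(x/\Delta)\rfloor_{\ge 0}$. *)

(* Defs.v *)
From HB Require Import structures.
From mathcomp Require Import all_boot all_order all_algebra.
From mathcomp Require Import all_classical all_reals all_analysis.

Set Implicit Arguments.
Unset Strict Implicit.
Unset Printing Implicit Defensive.

Import Order.TTheory GRing.Theory Num.Theory.

Local Open Scope classical_set_scope.
Local Open Scope ring_scope.

(** ** Lists of costs *)

(* The list is finite or infinite: [A i] is its entry of index [i], and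
   [A i = +oo] means that the list has at most [i] entries. *)
Definition cost_list (R : realType) (A : nat -> \bar R) : Prop :=
  nondecreasing_seq A /\ forall i, (1%:E <= A i)%E.

Definition costs (R : realType) (A : nat -> \bar R) : set R :=
  [set v | exists i, A i = v%:E].

(* Counts indices, so repeated entries are counted separately; the value is
   [+oo] when infinitely many entries are at most [C]. *)
Definition ncost (R : realType) (A : nat -> \bar R) (C : R) : \bar R :=
  counting [set i | (A i <= C%:E)%E].

(* A nonempty set of entries of a nondecreasing list has a least element, so
   the infima below are minima; [Ccrit] and [cost_gt] are [+oo] when there is
   no such entry. *)
Definition Cmin (R : realType) (A : nat -> \bar R) : R := inf (costs A).

Definition Ccrit (R : realType) (A : nat -> \bar R) (b : nat) : \bar R :=
  ereal_inf (EFin @` [set v | costs A v /\ (b%:R%:E < ncost A v)%E]).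

Definition cost_gt (R : realType) (A : nat -> \bar R) (C : R) : \bar R :=
  ereal_inf (EFin @` [set v | costs A v /\ C < v]).

(* Used only at entries [C] of the list, where the supremum is a maximum. *)
Definition cost_le (R : realType) (A : nat -> \bar R) (C : R) : R :=
  sup [set v | costs A v /\ v <= C].

Definition delta (R : realType) (A : nat -> \bar R) (C : R) : \bar R :=
  (cost_gt A C - (cost_le A C)%:E)%E.

(** ** Queries *)

Inductive feedback := Limited | Integer | Extended.

Definition terminating (R : realType) (A : nat -> \bar R) (Cstar C : R)
    (b : nat) : Prop :=
  (ncost A Cstar <= ncost A C)%E /\ (ncost A C <= b%:R%:E)%E.

(* A closed interval is the pair of its endpoints.  [query f A C b I]: [I] is
   a possible answer to a query that is not terminating. *)
Definition query (R : realType) (f : feedback) (A : nat -> \bar R) (C : R)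
    (b : nat) (I : \bar R * \bar R) : Prop :=
  if (C%:E < Ccrit A b)%E then
    I = (match f with
         | Limited => C%:E
         | Integer => ((Num.floor C)%:~R + 1)%:E
         | Extended => cost_gt A C
         end, +oo%E)
  else
    match f with
    | Limited | Integer => I = (1%:E, C%:E)
    | Extended => exists v : R,
        [/\ costs A v, (Ccrit A b <= v%:E)%E, v <= C & I = (1%:E, v%:E)]
    end.

(** ** Uniform Budgeted Scheduler *)

(* [Terminated]: the call ended the whole interaction with a solution. *)
Inductive outcome := Running | Halted | Terminated.

(* [memory] holds the states stored by all programs, [expanded] is the number
   of expansions made so far. *)
Record config (S : Type) := Config {
  queue : seq (nat * nat);
  memory : S;
  expanded : nat;
  terminated : bool }.

(* [run_prog k b s s' e o]: the call of program [k] with budget [b] may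
   change the memory from [s] to [s'], make [e] expansions and end with
   outcome [o].  Ties between pairs of minimal [T]-value are broken
   arbitrarily, so the order of the sequence [queue c] is irrelevant. *)
Definition ubs_step (S : Type) (T : nat -> nat -> nat)
    (run_prog : nat -> nat -> S -> S -> nat -> outcome -> Prop)
    (c c' : config S) : Prop :=
  exists (k r e : nat) (o : outcome),
    [/\ (k, r) \in queue c,
        (forall k' r', (k', r') \in queue c -> (T k r <= T k' r')%N),
        run_prog k (T k r - T k r.-1)%N (memory c) (memory c') e o,
        expanded c' = (expanded c + e)%N &
        terminated c' = (if o is Terminated then true else false) /\
        queue c' = (if r == 1%N then [:: (k.+1, 1%N)] else [::]) ++
                   (if o is Halted then [::] else [:: (k, r.+1)]) ++
                   rem (k, r) (queue c)].

(* The configuration is repeated forever once the scheduler has stopped. *)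
Definition ubs_execution (S : Type) (T : nat -> nat -> nat)
    (run_prog : nat -> nat -> S -> S -> nat -> outcome -> Prop) (s0 : S)
    (c : nat -> config S) : Prop :=
  c 0%N = Config [:: (1%N, 1%N)] s0 0%N false /\
  forall t, if terminated (c t) || nilp (queue (c t)) then c t.+1 = c t
            else ubs_step T run_prog (c t) (c t.+1).

(** ** DovIBEX *)

Definition dovibex_T (k r : nat) : nat := (r * 2 ^ k)%N.

(* The low end of a stored interval is always finite. *)
Definition next_limit (R : realType) (I : \bar R * \bar R) : R :=
  if I.2 == +oo%E then 2 * fine I.1 else (fine I.1 + fine I.2) / 2.

(* A query makes at most [min {b, n(C)}] expansions, not exactly that many. *)
Definition dovibex_prog (R : realType) (f : feedback) (A : nat -> \bar R)
    (Cstar : R) (k b : nat) (s s' : nat -> \bar R * \bar R) (e : nat)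
    (o : outcome) : Prop :=
  let C := next_limit (s k) in
  (e%:R%:E <= mine b%:R%:E (ncost A C))%E /\
  ((terminating A Cstar C b /\ o = Terminated /\ s' = s) \/
   (~ terminating A Cstar C b /\
    exists I, query f A C b I /\
      let lo := maxe (s k).1 I.1 in
      let hi := mine (s k).2 I.2 in
      if (hi <= lo)%E then o = Halted /\ s' = s
      else o = Running /\ s' = (fun j => if j == k then (lo, hi) else s j))).

Definition dovibex_execution (R : realType) (f : feedback)
    (A : nat -> \bar R) (Cstar : R)
    (c : nat -> config (nat -> \bar R * \bar R)) : Prop :=
  ubs_execution dovibex_T (dovibex_prog f A Cstar)
    (fun=> ((Cmin A)%:E, +oo%E)) c.

(** ** Bounds *)

Definition log2 (R : realType) (x : R) : R := ln x / ln 2.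

(* For [Delta = +oo], [log2 (x / Delta)] is [-oo] and its truncation is 0. *)
Definition nexp (R : realType) (eps x : R) (Delta : \bar R) : int :=
  1 + Num.max 1 (Num.ceil (log2 (x / eps)))
    + (if Delta is d%:E then Num.max 0 (Num.floor (log2 (x / d))) else 0).

Definition Zdelta (R : realType) (A : nat -> \bar R) (Cstar : R) : R :=
  2 * fine (ncost A Cstar) * (nexp (Cmin A) Cstar (delta A Cstar))%:~R.

(* The infimum of a nonempty set of natural numbers, hence a minimum. *)
Definition Zcrit (R : realType) (A : nat -> \bar R) (Cstar : R) : R :=
  inf [set b%:R * (nexp (Cmin A) Cstar (Ccrit A b - Cstar%:E)%E)%:~R
      | b in [set b : nat | (ncost A Cstar <= b%:R%:E)%E]].

(* Main.v *)
Require Import Defs.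
From HB Require Import structures.
From mathcomp Require Import all_boot all_order all_algebra.
From mathcomp Require Import all_classical all_reals all_analysis.
From mathcomp Require Import zify lra.

Import Order.TTheory GRing.Theory Num.Theory.

Local Open Scope classical_set_scope.
Local Open Scope ring_scope.

(** Let [b >= n_*].  A query of budget [2^k >= b] that does not terminate has
    its limit below [C*] or at least at [Ccrit (2^k) >= Ccrit b], so the
    interval of program [k] always contains [C*] and [Ccrit (2^k)] and the
    program never halts.  While the high end is infinite the limit doubles,
    which happens at most [log2 (C* / Cmin)] times (rounded up, at least once);
    then the width, at most [C*], is halved by every query and stays at least
    [Ccrit b - C*].  So program [k] terminates within [M = nexp] calls.  Until
    then the scheduler has a pair of [T]-value at most [B = M 2^k] to extract,
    so every call [(j, r)] satisfies [r 2^j <= B], and the [log2 B] programs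
    that can be called make at most [B] expansions each.  The least [k >= 1]
    with [2^k >= b] has [2^k <= 2 b]; [b = n_*] gives the first bound and the
    minimizer [b] of [Zcrit] gives the second. *)

(** * Budget accounting for the scheduler *)

(** The total budget handed out to programs up to [L]. It dominates the expansions, and also the
    number of scheduler steps, since every budget is at least 1. *)
Definition calls_time (g : nat -> nat) (L : nat) : nat :=
  (\sum_(j < L.+1) g j * 2 ^ j)%N.

Lemma calls_time_add (g : nat -> nat) (L k : nat) : (k <= L)%N ->
  calls_time (fun j => g j + (j == k))%N L = (calls_time g L + 2 ^ k)%N.
Proof.
move=> kL; rewrite /calls_time.
under eq_bigr do rewrite mulnDl.
rewrite big_split /=; congr addn.
have kL' : (k < L.+1)%N by [].
rewrite (bigD1 (Ordinal kL')) //= eqxx mul1n big1 ?addn0 // => i.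
by rewrite -val_eqE /= => /negbTE ->; rewrite mul0n.
Qed.

(** Programs are numbered from 1, so the term of index 0 vanishes and the factor is [L], not
    [L.+1]. *)
Lemma calls_time_le (g : nat -> nat) (B L : nat) :
  g 0%N = 0%N -> (forall j, g j * 2 ^ j <= B)%N -> (calls_time g L <= B * L)%N.
Proof.
move=> g0 gB; rewrite /calls_time big_ord_recl /= g0 mul0n add0n.
rewrite mulnC -[X in (_ <= X * _)%N]card_ord -sum_nat_const.
by apply: leq_sum => i _; exact: gB.
Qed.

(* [g j] counts the calls of program [j] so far, [F] is the program that was
   inserted last, and [B] bounds the [T]-value of every call. *)
Record ubs_inv {S : Type} (Phi : nat -> S -> Prop) (k B t : nat)
    (c : config S) (g : nat -> nat) (F : nat) : Prop := UbsInv {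
  inv_uniq : uniq (queue c);
  inv_queue : forall j r, (j, r) \in queue c -> r = (g j).+1 /\ (0 < j <= F)%N;
  inv_last : (F, 1%N) \in queue c;
  inv_calls : forall j, (0 < g j)%N = (0 < j < F)%N;
  inv_le : forall j, (g j * 2 ^ j <= B)%N;
  inv_steps : (t <= calls_time g (trunc_log 2 B))%N;
  inv_expanded : (expanded c <= calls_time g (trunc_log 2 B))%N;
  inv_Phi : Phi (g k) (memory c);
  inv_prog : (k <= F)%N -> (k, (g k).+1) \in queue c }.

Arguments inv_last {S Phi k B t c g F}.
Arguments inv_calls {S Phi k B t c g F}.
Arguments inv_le {S Phi k B t c g F}.
Arguments inv_steps {S Phi k B t c g F}.

(** [Phi r s] abstracts what is known of program [k] after its [r] calls. It forces [r < M] and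
    excludes halting, so this one program controls the whole schedule. *)
Lemma ubs_inv_step {S : Type}
    {run_prog : nat -> nat -> S -> S -> nat -> outcome -> Prop}
    {Phi : nat -> S -> Prop} {k M t : nat} {c c' : config S}
    {g : nat -> nat} {F : nat} :
  (0 < k)%N ->
  (forall j b s s' e o, run_prog j b s s' e o -> e <= b)%N ->
  (forall r s, Phi r s -> r < M)%N ->
  (forall r s s' e o, Phi r s -> run_prog k (2 ^ k)%N s s' e o ->
     o = Terminated \/ o = Running /\ Phi r.+1 s') ->
  (forall j r b s s' e o, j != k -> Phi r s -> run_prog j b s s' e o ->
     Phi r s') ->
  ubs_inv Phi k (M * 2 ^ k) t c g F ->
  ubs_step dovibex_T run_prog c c' ->
  (expanded c' <= M * 2 ^ k * trunc_log 2 (M * 2 ^ k))%N /\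
  (~~ terminated c' ->
   exists g' F', ubs_inv Phi k (M * 2 ^ k) t.+1 c' g' F').
Proof.
move=> k0 run_le PhiM Phik Phij [qU qg qF gF gB gt ge gPhi gk].
move=> [i [r [e [ o [irq Tmin run ec' [term' qc']]]]]].
set B := (M * 2 ^ k)%N in gB gt ge *; set L := trunc_log 2 B in gt ge *.
have [rE iF] := qg _ _ irq.
have gF0 : g F = 0%N by have [[<-]] := qg _ _ qF.
have M0 : (0 < M)%N by have := PhiM _ _ gPhi; lia.
(* The extracted pair is no later than program [k]'s own pair if [k <= F], and otherwise no later
   than [(F, 1)], whose [T]-value [2 ^ F] is below [2 ^ k]. *)
have TB : ((g i).+1 * 2 ^ i <= B)%N.
  rewrite -rE; have [kF|Fk] := leqP k F.
    by apply: leq_trans (Tmin _ _ (gk kF)) _; rewrite leq_mul2r (PhiM _ _ gPhi) orbT.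
  apply: leq_trans (Tmin _ _ qF) _.
  by rewrite /dovibex_T /B leq_mul // leq_exp2l // ltnW.
have iL : (i <= L)%N.
  apply: trunc_log_max => //.
  by apply: leq_trans TB; rewrite leq_pmull.
have budget : (dovibex_T i r - dovibex_T i r.-1 = 2 ^ i)%N.
  by rewrite rE /dovibex_T /= mulSn addnK.
rewrite budget in run.
have eb := run_le _ _ _ _ _ _ run.
pose g' j := (g j + (j == i))%N.
have g'L : calls_time g' L = (calls_time g L + 2 ^ i)%N by exact: calls_time_add.
have g'B j : (g' j * 2 ^ j <= B)%N.
  by rewrite /g'; case: eqVneq => [->|_]; rewrite ?addn1 ?addn0.
have eg' : (expanded c' <= calls_time g' L)%N by rewrite ec' g'L leq_add.
have g0 : g' 0%N = 0%N.
  have := gF 0%N; rewrite /g' ltnn /=.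
  by case: (eqVneq 0%N i) iF => [<- //|_ _]; case: (g 0%N).
split; first by apply: leq_trans eg' _; exact: calls_time_le.
move=> nterm; have oT : o <> Terminated by move=> oE; move: nterm; rewrite term' oE.
(* By [inv_calls], only the program inserted last is in the queue without having been called. *)
have r1 : (r == 1%N) = (i == F).
  rewrite rE eqSS; apply/idP/idP => [/eqP gi0|/eqP ->]; last by rewrite gF0.
  by have := gF i; rewrite gi0; lia.
have rem_ne j s : (j, s) \in rem (i, r) (queue c) -> (j != i) && ((j, s) \in queue c).
  rewrite mem_rem_uniq // inE => /andP[jsir jsq]; rewrite jsq andbT.
  apply: contra jsir => /eqP ji; have [-> _] := qg _ _ jsq.
  by rewrite rE ji.
have rem_in j s : j != i -> (j, s) \in queue c -> (j, s) \in rem (i, r) (queue c).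
  move=> ji jsq; rewrite mem_rem_uniq // inE jsq andbT.
  by apply: contra ji => /eqP[->].
exists g', (if i == F then F.+1 else F); split=> //.
- have Unew : uniq ((if o is Halted then [::] else [:: (i, r.+1)]) ++
      rem (i, r) (queue c)).
    have inew : (i, r.+1) \notin rem (i, r) (queue c).
      by apply/negP => /rem_ne/andP[]; rewrite eqxx.
    by case: (o) => /=; rewrite ?inew rem_uniq.
  rewrite qc' r1; case: (eqVneq i F) => // iF'.
  rewrite cat1s cons_uniq Unew andbT mem_cat negb_or; apply/andP; split.
    case: (o) => //=; rewrite inE xpair_eqE; lia.
  by apply/negP => /rem_ne/andP[_ /qg]; lia.
- move=> j s; rewrite qc' r1 !mem_cat => /or3P[].
  + case: (eqVneq i F) => //= iF'; rewrite inE => /eqP[-> ->].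
    have := gF F.+1; rewrite /g' iF'; lia.
  + by case: o {Phik Phij run term' oT qc'} => //=; rewrite inE => /eqP[-> ->];
       rewrite /g' eqxx addn1 rE; split => //; case: ifP; lia.
  + move=> /rem_ne/andP[/negbTE ji /qg[-> jF]]; rewrite /g' ji addn0; split => //.
    by case: ifP; lia.
- rewrite qc' r1 !mem_cat; case: (eqVneq i F) => iF'; first by rewrite iF' mem_seq1 eqxx.
  by rewrite rem_in ?orbT // eq_sym.
- move=> j; rewrite /g'; have := gF j; case: (eqVneq i F); case: (eqVneq j i); lia.
- by rewrite -/L g'L; have := expn_gt0 2 i; lia.
- rewrite /g'; case: (eqVneq k i) => [ki|ki]; last first.
    by rewrite addn0; apply: Phij gPhi run; rewrite eq_sym.
  by rewrite addn1; rewrite -ki in run; case: (Phik _ _ _ _ _ gPhi run) => // -[].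
(* If program [k] was just called, it is reinserted because it is [Running]. Otherwise its pair
   either stays or, for [k = F.+1], is the one just added. *)
- move=> kF; rewrite qc' r1 !mem_cat /g'; case: (eqVneq k i) => [ki|ki].
    have oR : o = Running.
      by rewrite -ki in run; case: (Phik _ _ _ _ _ gPhi run) => // -[].
    by rewrite oR ki inE addn1 rE eqxx orbT.
  rewrite addn0; move: kF; case: (eqVneq i F) => iF' kF.
    have [kF'|kF'] := leqP k F; first by rewrite (rem_in _ _ ki (gk kF')) !orbT.
    have -> : k = F.+1 by lia.
    by have := gF F.+1; rewrite -iF' inE xpair_eqE eqxx; case: (g _) => //; lia.
  by rewrite (rem_in _ _ ki (gk kF)) !orbT.
Qed.

Lemma ubs_expanded {S : Type}
    {run_prog : nat -> nat -> S -> S -> nat -> outcome -> Prop}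
    (Phi : nat -> S -> Prop) (k M : nat) {s0 : S} {c : nat -> config S} :
  (0 < k)%N ->
  (forall j b s s' e o, run_prog j b s s' e o -> e <= b)%N ->
  Phi 0%N s0 ->
  (forall r s, Phi r s -> r < M)%N ->
  (forall r s s' e o, Phi r s -> run_prog k (2 ^ k)%N s s' e o ->
     o = Terminated \/ o = Running /\ Phi r.+1 s') ->
  (forall j r b s s' e o, j != k -> Phi r s -> run_prog j b s s' e o ->
     Phi r s') ->
  ubs_execution dovibex_T run_prog s0 c ->
  (exists t, terminated (c t)) /\
  forall t, (expanded (c t) <= M * 2 ^ k * trunc_log 2 (M * 2 ^ k))%N.
Proof.
move=> k0 run_le Phi0 PhiM Phik Phij [c0 cS].
set B := (M * 2 ^ k)%N.
have inv t : (expanded (c t) <= B * trunc_log 2 B)%N /\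
    (~~ terminated (c t) -> exists g F, ubs_inv Phi k B t (c t) g F).
  elim: t => [|t [IHe IHt]].
    rewrite c0; split=> // _; exists (fun=> 0%N), 1%N; split=> //=.
    - by move=> j r; rewrite inE => /eqP[-> ->].
    - by move=> j; lia.
    - by move=> k1; rewrite inE xpair_eqE; lia.
  have := cS t; case: (boolP (terminated (c t))) => [term|nterm] /=.
    by move=> ->; split=> //; rewrite term.
  have [g [F Hinv]] := IHt nterm.
  case: nilP => [q0|_]; first by have := inv_last Hinv; rewrite q0.
  exact: (ubs_inv_step k0 run_le PhiM Phik Phij Hinv).
split; last by move=> t; have [] := inv t.
(* By [inv_steps], a run still going after this many steps would have handed out more budget than
   [calls_time_le] allows. *)
exists (B * trunc_log 2 B).+1; apply: contrapT => /negP nterm.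
have [_ /(_ nterm) [g [F Hinv]]] := inv (B * trunc_log 2 B).+1.
have := inv_steps Hinv; rewrite leqNgt ltnS calls_time_le //.
  by have := inv_calls Hinv 0%N; case: (g 0%N).
exact: inv_le Hinv.
Qed.

(** * Logarithms, cost lists and single queries *)

Lemma ln2_gt0 (R : realType) : 0 < ln (2 : R).
Proof. by rewrite ln_gt0 // ltr1n. Qed.

Lemma le_log2 {R : realType} (j : nat) {x : R} :
  0 < x -> (j%:R <= log2 x) = (2 ^+ j <= x).
Proof.
move=> x0; rewrite /log2 ler_pdivlMr ?ln2_gt0 // mulr_natl -lnXn //.
by rewrite ler_ln // posrE exprn_gt0.
Qed.

Lemma lt_log2 {R : realType} (j : nat) {x : R} :
  0 < x -> (j%:R < log2 x) = (2 ^+ j < x).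
Proof.
move=> x0; rewrite /log2 ltr_pdivlMr ?ln2_gt0 // mulr_natl -lnXn //.
by rewrite ltr_ln // posrE exprn_gt0.
Qed.

Lemma le_ncost {R : realType} (A : nat -> \bar R) {C D : R} :
  C <= D -> (ncost A C <= ncost A D)%E.
Proof.
move=> CD; apply: le_measure; rewrite ?inE // => i /= /le_trans; apply.
by rewrite lee_fin.
Qed.

Lemma counting_II (R : realType) (n : nat) :
  counting `I_n = n%:R%:E :> \bar R.
Proof.
have fn : finite_set `I_n by exact: finite_II.
by rewrite /counting asboolT // (card_fset_set (card_eqxx _)).
Qed.

Section costs.
Context {R : realType} {A : nat -> \bar R} (hA : cost_list A).


Lemma costs_ge1 {v} : costs A v -> 1 <= v.
Proof. by move=> [i Ai]; have := hA.2 i; rewrite Ai lee_fin. Qed.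

Lemma costsP {C i} : (A i <= C%:E)%E -> exists2 v, A i = v%:E & v <= C.
Proof.
by have := hA.2 i; case: (A i) => // v _ vC; exists v => //; rewrite -lee_fin.
Qed.

(** In a sorted list the indices of entries at most [C] form an initial segment, and it has more
    than [b] elements exactly when it contains index [b]. *)
Lemma ncost_leP C b : (b%:R%:E < ncost A C)%E = (A b <= C%:E)%E.
Proof.
apply/idP/idP => [|Ab]; last first.
  apply: (@lt_le_trans _ _ (counting `I_b.+1)).
    by rewrite counting_II lte_fin ltr_nat.
  apply: le_measure; rewrite ?inE // => i /= ib.
  by apply: le_trans Ab; apply: hA.1.
apply: contraPT => /negP Ab; apply/negP; rewrite -leNgt -counting_II.
apply: le_measure; rewrite ?inE // => i /= Ai; rewrite ltnNge; apply/negP => bi.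
by apply: Ab; apply: le_trans Ai; apply: hA.1.
Qed.

Lemma ncost_le_lt_Ccrit {C b} : (C%:E < Ccrit A b)%E -> (ncost A C <= b%:R%:E)%E.
Proof.
apply: contraTT; rewrite -!ltNge -leNgt ncost_leP => Ab.
have [v Av vC] := costsP Ab.
apply: (@le_trans _ _ v%:E); last by rewrite lee_fin.
apply: ereal_inf_lbound; exists v => //; split; first by exists b.
by rewrite ncost_leP Av.
Qed.

Lemma le_Ccrit {b b'} : (b <= b')%N -> (Ccrit A b <= Ccrit A b')%E.
Proof.
move=> bb; apply: ereal_inf_le_tmp => _ [v [cv vb] <-]; exists v => //; split => //.
by apply: le_lt_trans vb; rewrite lee_fin ler_nat.
Qed.

Lemma Cmin_ge1 {v} : costs A v -> 1 <= Cmin A.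
Proof.
by move=> cv; apply: lb_le_inf; [exists v | move=> w /costs_ge1].
Qed.

Lemma Cmin_le {v} : costs A v -> Cmin A <= v.
Proof. by move=> cv; apply: ge_inf => //; exists 1 => w /costs_ge1. Qed.

(** Strictness holds because the infimum is attained at the first index whose entry exceeds [C], or
    is [+oo] if there is none. *)
Lemma lt_cost_gt C : (C%:E < cost_gt A C)%E.
Proof.
have [ex|nex] := pselect (exists i, `[< exists2 v, A i = v%:E & C < v >]); last first.
  rewrite /cost_gt (_ : [set v | _] = set0) ?image_set0 ?ereal_inf0 ?ltry //.
  apply/seteqP; split=> // v /= [[i Ai] Cv]; apply: nex.
  by exists i; apply/asboolP; exists v.
case: (ex_minnP ex) => i /asboolP[v Ai Cv] imin.
apply: (@lt_le_trans _ _ v%:E); first by rewrite lte_fin.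
apply: le_ereal_inf_tmp => _ [w [[j Aj] Cw] <-].
by rewrite -Ai -Aj; apply: hA.1; apply: imin; apply/asboolP; exists w.
Qed.

Lemma cost_gt_le_Ccrit {C b} :
  (ncost A C <= b%:R%:E)%E -> (cost_gt A C <= Ccrit A b)%E.
Proof.
move=> Cb; apply: ereal_inf_le_tmp => _ [v [cv vb] <-]; exists v => //; split => //.
rewrite ltNge; apply/negP => vC; have := lt_le_trans vb (le_ncost A vC).
by rewrite ltNge Cb.
Qed.

Lemma cost_leE {C} : costs A C -> cost_le A C = C.
Proof.
move=> cC; apply/eqP; rewrite eq_le; apply/andP; split.
  by apply: ge_sup; [exists C | move=> v []].
by apply: ub_le_sup => //; exists C => v [].
Qed.

(** Raising the low end never passes [Cstar]: it is an entry above [C], hence at least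
    [cost_gt A C], and at least [floor C + 1] if it is an integer. *)
Lemma query_below {f} {Cstar C : R} {b I} :
  (f = Integer -> forall v, costs A v -> v \is a Num.int) ->
  costs A Cstar -> (C%:E < Ccrit A b)%E -> C < Cstar ->
  query f A C b I -> exists x, [/\ I = (x%:E, +oo%E), C <= x & x <= Cstar].
Proof.
move=> fint cs Cc CC; rewrite /query Cc => ->.
case: f fint => [_|/(_ erefl) int|_].
- by exists C; split => //; exact: ltW.
- exists ((Num.floor C)%:~R + 1); split => //.
    by have /andP[_] := floor_itv C; rewrite intrD => /ltW.
  have /intrP[z Cz] := int _ cs.
  rewrite Cz -(intrD _ _ 1) ler_int lezD1 -(ltr_int R) -Cz.
  by apply: le_lt_trans CC; exact: floor_le.
- have gs : (cost_gt A C <= Cstar%:E)%E by apply: ereal_inf_lbound; exists Cstar.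
  have := lt_cost_gt C; move: gs; case: (cost_gt A C) => // x; rewrite lee_fin lte_fin.
  by move=> xs Cx; exists x; split => //; exact: ltW.
Qed.

Lemma query_above {f} {C : R} {b I} :
  (Ccrit A b <= C%:E)%E -> query f A C b I ->
  exists v, [/\ I = (1%E, v%:E), (Ccrit A b <= v%:E)%E & v <= C].
Proof.
move=> Cc; rewrite /query ltNge Cc /=; case: f => [->|->|].
- by exists C.
- by exists C.
- by move=> [v [_ vb vC ->]]; exists v.
Qed.

End costs.

(* The interval of a program of budget [b] after [r] queries: the high end is
   still infinite, or it became finite within [m] queries and the width was
   halved at least [j] times since then. *)
Definition dovibex_inv {R : realType} (A : nat -> \bar R) (Cstar : R)
    (b m r : nat) (I : \bar R * \bar R) : Prop :=
  exists l : R, [/\ I.1 = l%:E, Cmin A <= l <= Cstar, (Ccrit A b <= I.2)%E &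
    [/\ I.2 = +oo%E, 2 ^+ r * Cmin A <= l & r = 0%N \/ 2 ^+ r * Cmin A < Cstar] \/
    exists h j, [/\ I.2 = h%:E, (r <= m + j)%N & 2 ^+ j * (h - l) <= Cstar]].

(** * Progress of a single program with a large enough budget *)

Section program.
Context {R : realType} {A : nat -> \bar R} {Cstar : R} {b : nat}.
Context (hA : cost_list A) (hCstar : costs A Cstar).
Context (hCcrit : (Cstar%:E < Ccrit A b)%E).

(** Such a program never passes the halting test. *)
Lemma dovibex_inv_lt {m r I} : dovibex_inv A Cstar b m r I -> (I.1 < I.2)%E.
Proof.
move=> [l [-> /andP[_ ls] cI _]].
by apply: lt_le_trans cI; apply: le_lt_trans hCcrit; rewrite lee_fin.
Qed.

Lemma dovibex_inv0 m : dovibex_inv A Cstar b m 0 ((Cmin A)%:E, +oo%E).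
Proof.
exists (Cmin A); split => //=; first by rewrite lexx (Cmin_le hA).
  by rewrite leey.
by left; split => //; [rewrite expr0 mul1r | left].
Qed.

Lemma dovibex_inv_step {f m r I J} :
  (f = Integer -> forall v, costs A v -> v \is a Num.int) ->
  (0 < m)%N ->
  (forall i, 2 ^+ i * Cmin A < Cstar -> (i < m)%N) ->
  dovibex_inv A Cstar b m r I ->
  ~ terminating A Cstar (next_limit I) b ->
  query f A (next_limit I) b J ->
  dovibex_inv A Cstar b m r.+1 (maxe I.1 J.1, mine I.2 J.2).
Proof.
move=> fint m0 hm [l [I1 /andP[Cl ls] cI phase]] nterm qJ.
have C1 := Cmin_ge1 hA hCstar.
have [Cc|Cc] := ltP (next_limit I)%:E (Ccrit A b).
  have CC : next_limit I < Cstar.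
    (* Below [Ccrit] the budget covers all [ncost] entries, so a limit at or above [Cstar] would
       terminate. *)
    rewrite ltNge; apply/negP => /(le_ncost A) nC; apply: nterm; split => //.
    exact: ncost_le_lt_Ccrit.
  have [x [-> Cx xs]] := query_below hA fint hCstar Cc CC qJ.
  exists (Num.max l x); rewrite I1 /= -EFin_max; split => //.
  - by rewrite le_max Cl ge_max ls xs.
  - by rewrite miney.
  move: CC Cx; rewrite /next_limit I1 /=.
  case: phase => [[I2 rl _]|[h [j [I2 rj hl]]]]; rewrite I2 /= ?eqxx => CC Cx.
    (* The limit is [2 * l], below [Cstar]; the new low end is at least that. *)
    left; split; rewrite ?miney //; last right; rewrite exprS -mulrA.
      by rewrite le_max (_ : _ <= x) ?orbT //; lra.
    by lra.
  right; exists h, j.+1; split; rewrite ?miney ?addnS //.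
  have : l + h <= 2 * Num.max l x.
    have : x <= Num.max l x by rewrite le_max lexx orbT.
    by lra.
  have := exprn_gt0 j (ltr0Sn R 1); rewrite exprS.
  move: (2 ^+ j) (Num.max l x) hl => p y; nra.
have [v [-> cv vC]] := query_above Cc qJ.
exists l; rewrite I1 /=; split => //.
- by rewrite -EFin_max; congr EFin; apply/max_idPl; lra.
- by rewrite Cl.
- by rewrite le_min cI.
move: vC; rewrite /next_limit I1 /=.
case: phase => [[I2 rl r0]|[h [j [I2 rj hl]]]]; rewrite I2 /= ?eqxx => vC; right.
  (* Here [v <= 2 * l], so the first finite width is at most [l <= Cstar]. The call numbered [r.+1]
     is within the first [m]: [0 < m] covers [r = 0], [hm] the rest. *)
  exists v, 0%N; split; rewrite ?minye //; last by rewrite expr0; lra.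
  by rewrite addn0; case: r0 => [->//|/hm].
exists (Num.min h v), j.+1; split; rewrite ?EFin_min ?addnS //.
have : 2 * Num.min h v <= l + h.
  have : Num.min h v <= v by rewrite ge_min lexx orbT.
  by lra.
have := exprn_gt0 j (ltr0Sn R 1); rewrite exprS.
move: (2 ^+ j) (Num.min h v) hl => p y; nra.
Qed.

(** At most [m] calls make the high end finite and at most [p] halvings follow, as the width stays
    at least [h - Cstar]. The extra 1 leaves room for the terminating call. *)
Lemma dovibex_inv_bound {m r p I} :
  (0 < m)%N ->
  (forall i, 2 ^+ i * Cmin A < Cstar -> (i < m)%N) ->
  (forall h j, (Ccrit A b <= h%:E)%E -> 2 ^+ j * (h - Cstar) <= Cstar ->
     (j <= p)%N) ->
  dovibex_inv A Cstar b m r I -> (r < (m + p).+1)%N.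
Proof.
move=> m0 hm hp [l [I1 /andP[Cl ls] cI phase]]; rewrite ltnS.
case: phase => [[I2 rl [->//|/hm]]|[h [j [I2 rj hl]]]]; first by lia.
apply: leq_trans rj _; rewrite leq_add2l; apply: (hp h); first by rewrite -I2.
apply: le_trans hl; rewrite ler_wpM2l ?exprn_ge0 //; lra.
Qed.

Lemma dovibex_expanded {f m p k c} :
  (f = Integer -> forall v, costs A v -> v \is a Num.int) ->
  (0 < m)%N ->
  (forall i, 2 ^+ i * Cmin A < Cstar -> (i < m)%N) ->
  (forall h j, (Ccrit A b <= h%:E)%E -> 2 ^+ j * (h - Cstar) <= Cstar ->
     (j <= p)%N) ->
  (0 < k)%N -> b = (2 ^ k)%N ->
  dovibex_execution f A Cstar c ->
  let Z := ((m + p).+1 * 2 ^ k)%N in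
  (exists t, terminated (c t)) /\
  forall t, (expanded (c t) <= Z * trunc_log 2 Z)%N.
Proof.
move=> fint m0 hm hp k0 bk.
apply: (ubs_expanded (fun r s => dovibex_inv A Cstar b m r (s k))) => //.
- move=> j b' s s' e o [+ _]; rewrite le_min => /andP[+ _].
  by rewrite lee_fin ler_nat.
- exact: dovibex_inv0.
- by move=> r s; exact: dovibex_inv_bound.
- move=> r s s' e o inv; rewrite -bk => -[_ [[_ [-> _]]|[nterm [J [qJ]]]]]; first by left.
  have inv' := dovibex_inv_step fint m0 hm inv nterm qJ.
  rewrite /= leNgt (dovibex_inv_lt inv') => -[-> ->]; right; split => //.
  by rewrite eqxx.
- move=> j r b' s s' e o jk inv [_ [[_ [_ ->//]]|[_ [J [_]]]]] /=.
  case: ifP => _ [_ ->] //.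
  by rewrite eq_sym (negbTE jk).
Qed.

End program.

(** * From the schedule to the two stated bounds *)

Lemma nexp_ge2 {R : realType} (eps x : R) Delta : 2 <= nexp eps x Delta.
Proof. by rewrite /nexp; case: Delta => [d||]; lia. Qed.

Lemma trunc_log_le_floor {R : realType} (Z : nat) : (0 < Z)%N ->
  (trunc_log 2 Z)%:Z <= Num.floor (log2 (Z%:R : R)).
Proof.
move=> Z0; rewrite floor_ge_int le_log2 ?ltr0n //.
by rewrite -natrX ler_nat trunc_logP.
Qed.

(** [Delta] is any positive lower bound on the gap between [Cstar] and [Ccrit A n], so that both
    bounds of the theorem are instances. *)
Lemma dovibex_expanded_nexp {R : realType} {f : feedback} {A : nat -> \bar R}
    {Cstar : R} {c} (n : nat) (Delta : \bar R) :
  cost_list A ->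
  (f = Integer -> forall v, costs A v -> v \is a Num.int) ->
  costs A Cstar ->
  (0 < n)%N -> (0 < Delta)%E -> (Cstar%:E + Delta <= Ccrit A n)%E ->
  dovibex_execution f A Cstar c ->
  let Z : R := 2 * (n%:R * (nexp (Cmin A) Cstar Delta)%:~R) in
  (exists t, terminated (c t)) /\
  forall t, (expanded (c t))%:R <= Z * (Num.floor (log2 Z))%:~R.
Proof.
move=> hA fint hCstar n0 D0 Dn exec Z.
have C1 := Cmin_ge1 hA hCstar.
have Cm0 : 0 < Cmin A := lt_le_trans ltr01 C1.
have Cs0 : 0 < Cstar := lt_le_trans Cm0 (Cmin_le hA hCstar).
pose m := absz (Num.max 1 (Num.ceil (log2 (Cstar / Cmin A)))).
pose p := absz (if Delta is d%:E then Num.max 0 (Num.floor (log2 (Cstar / d))) else 0).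
have ME : nexp (Cmin A) Cstar Delta = (m + p).+1%:Z.
  by rewrite /nexp /m /p; case: (Delta) => [d||]; lia.
(* The maximum with 1 is there because no program has number 0; for [n = 1] it gives [2 ^ k = 2 * n]
   exactly. *)
pose k := maxn 1 (up_log 2 n).
have nk : (n <= 2 ^ k)%N.
  by apply: leq_trans (up_logP n (isT : 1 < 2)%N) _; rewrite leq_exp2l // leq_maxr.
have kn : (2 ^ k <= 2 * n)%N.
  rewrite /k; have [n1|n1] := leqP n 1; first by have -> : n = 1%N by lia.
  have /andP[+ _] := up_log_bounds (isT : 1 < 2)%N n1.
  rewrite (maxn_idPr _) ?up_log_gt0 // => un.
  have := up_log_gt0 2 n; rewrite n1.
  by case: (up_log 2 n) un => //= u un _; rewrite expnS; lia.
have Ck := le_trans Dn (le_Ccrit nk).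
have hCcrit : (Cstar%:E < Ccrit A (2 ^ k))%E.
  by apply: lt_le_trans Ck; rewrite lteDl.
have hm i : 2 ^+ i * Cmin A < Cstar -> (i < m)%N.
  rewrite -ltr_pdivlMr // -lt_log2 ?divr_gt0 //.
  by rewrite -(ceil_gt_int _ i%:Z) /m; move: (Num.ceil _); lia.
have hp h j : (Ccrit A (2 ^ k) <= h%:E)%E -> 2 ^+ j * (h - Cstar) <= Cstar -> (j <= p)%N.
  (* For [Delta = +oo] no finite high end [h] is possible. *)
  move=> /(le_trans Ck); rewrite /p; case: Delta D0 {Dn Ck Z p ME} => // d.
  rewrite lte_fin lee_fin => d0 dh jh.
  suff : j%:Z <= Num.floor (log2 (Cstar / d)) by lia.
  rewrite floor_ge_int le_log2 ?divr_gt0 // ler_pdivlMr //; apply: le_trans jh.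
  by rewrite ler_wpM2l ?exprn_ge0 // lerBrDl.
have m0 : (0 < m)%N by rewrite /m; lia.
have k0 : (0 < k)%N by rewrite /k; lia.
have [term bound] := dovibex_expanded hA hCstar hCcrit fint m0 hm hp k0 erefl exec.
split=> // t; set Z0 := ((m + p).+1 * 2 ^ k)%N in bound.
pose Z1 := (2 * (n * (m + p).+1))%N.
have ZE : Z = Z1%:R by rewrite /Z ME /Z1 !natrM.
have Z01 : (Z0 <= Z1)%N by rewrite /Z0 /Z1 mulnC mulnA leq_mul2r kn orbT.
apply: (@le_trans _ _ (Z1%:R * (trunc_log 2 Z1)%:R)).
  rewrite -natrM ler_nat; apply: leq_trans (bound t) _.
  by rewrite leq_mul // leq_trunc_log.
rewrite ZE ler_wpM2l // -[X in X <= _]/((trunc_log 2 Z1)%:Z%:~R) ler_int.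
by rewrite trunc_log_le_floor // /Z1; lia.
Qed.

Lemma ncost_nat {R : realType} {A : nat -> \bar R} {C : R} :
  cost_list A -> costs A C -> ncost A C \is a fin_num ->
  exists2 n : nat, (0 < n)%N & ncost A C = n%:R%:E.
Proof.
move=> hA [i Ai]; have : (0%:R%:E < ncost A C)%E.
  by rewrite (ncost_leP hA) -Ai; apply: hA.1.
rewrite /ncost /counting; case: ifP => // _ n0 _.
by eexists; last reflexivity; move: n0; rewrite lte_fin ltr_nat.
Qed.

(** The values are natural numbers since [nexp] is positive, so a least one is attained. *)
Lemma Zcrit_min {R : realType} {A : nat -> \bar R} {Cstar : R} {n : nat} :
  (ncost A Cstar <= n%:R%:E)%E ->
  exists2 b : nat, (ncost A Cstar <= b%:R%:E)%E &
    Zcrit A Cstar =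
      b%:R * (nexp (Cmin A) Cstar (Ccrit A b - Cstar%:E)%E)%:~R.
Proof.
move=> hn; pose z b := (b * absz (nexp (Cmin A) Cstar (Ccrit A b - Cstar%:E)%E))%N.
have zE b : b%:R * (nexp (Cmin A) Cstar (Ccrit A b - Cstar%:E)%E)%:~R = (z b)%:R :> R.
  rewrite natrM; congr (_ * _); rewrite -[RHS]/(Posz _)%:~R; congr (_%:~R).
  by have := nexp_ge2 (Cmin A) Cstar (Ccrit A b - Cstar%:E)%E; lia.
pose P i := `[< exists2 b : nat, (ncost A Cstar <= b%:R%:E)%E & z b = i >].
have exP : exists i, P i by exists (z n); apply/asboolP; exists n.
case: (ex_minnP exP) => i /asboolP[b hb zb] imin; exists b => //.
apply/eqP; rewrite eq_le; apply/andP; split.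
  apply: ge_inf; last by exists b.
  by exists 0 => _ [j _ <-]; rewrite zE ler0n.
apply: lb_le_inf => [|_ [j hj <-]]; first by eexists; exists b.
by rewrite !zE ler_nat zb; apply: imin; apply/asboolP; exists j.
Qed.

Theorem theorem3 (R : realType) :
  exists K : R,
  forall (f : feedback) (A : nat -> \bar R) (Cstar : R)
    (c : nat -> config (nat -> \bar R * \bar R)),
    cost_list A ->
    (f = Integer -> forall v, costs A v -> v \is a Num.int) ->
    costs A Cstar ->
    ncost A Cstar \is a fin_num ->
    dovibex_execution f A Cstar c ->
    exists t : nat,
      [/\ terminated (c t),
          (expanded (c t))%:R <=
            Zdelta A Cstar * (Num.floor (log2 (Zdelta A Cstar)))%:~R &
          (expanded (c t))%:R <=
            K * (Zcrit A Cstar * log2 (Zcrit A Cstar))].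
Proof.
(* With [z = Zcrit A Cstar >= 2], the bound [2 * z * log2 (2 * z)] equals [2 * z * (1 + log2 z)],
   and [1 <= log2 z] gives the constant 4. *)
exists 4 => f A Cstar c hA fint hCstar fn exec.
have [n n0 nE] := ncost_nat hA hCstar fn.
have hn : (ncost A Cstar <= n%:R%:E)%E by rewrite nE.
have gtC := lt_cost_gt hA Cstar.
have leg b : (ncost A Cstar <= b%:R%:E)%E -> (cost_gt A Cstar <= Ccrit A b)%E.
  exact: cost_gt_le_Ccrit.
have [[t term] bound1] : (exists t, terminated (c t)) /\
    forall t, (expanded (c t))%:R <=
      Zdelta A Cstar * (Num.floor (log2 (Zdelta A Cstar)))%:~R.
  have -> : Zdelta A Cstar =
      2 * (n%:R * (nexp (Cmin A) Cstar (delta A Cstar))%:~R).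
    by rewrite /Zdelta nE mulrA.
  apply: (dovibex_expanded_nexp n (delta A Cstar) hA fint hCstar) => //;
    rewrite /delta cost_leE ?sube_gt0 //.
  by rewrite addeC subeK // leg.
exists t; split => //.
have [b hb ZE] := Zcrit_min hn.
have b0 : (0 < b)%N.
  by apply: leq_trans n0 _; rewrite nE lee_fin ler_nat in hb.
have [||_ /(_ t)] :=
  dovibex_expanded_nexp b (Ccrit A b - Cstar%:E)%E hA fint hCstar b0 _ _ exec.
- by rewrite sube_gt0; apply: lt_le_trans gtC (leg _ hb).
- by rewrite addeC subeK.
rewrite -ZE => bound2; apply: le_trans bound2 _.
set z := Zcrit A Cstar in ZE *.
have z2 : 2 <= z.
  rewrite ZE; have := nexp_ge2 (Cmin A) Cstar (Ccrit A b - Cstar%:E)%E.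
  rewrite -(ler_int R) => M2; rewrite -[2]mul1r ler_pM ?ler1n //.
have l1 : 1 <= log2 z by have := @le_log2 R 1 z; rewrite expr1 => ->; lra.
have l2 : log2 (2 * z) = 1 + log2 z.
  rewrite /log2 lnM ?posrE //; last by lra.
  by rewrite mulrDl divff // gt_eqF // ln2_gt0.
have := floor_le (log2 (2 * z)); rewrite l2.
by move: (_%:~R) => w; nra.
Qed.
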